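(* Let $\{\rho_k\}$ and $\{\epsilon_k\}$ be sequences of positive numbers with $\rho_k\to\infty$ and $\epsilon_k\to 0$. For each $k\ge 0$, let $(x^k,y^k,z^k)$ be an $\epsilon_k$-optimal solution of the minimax problem $\min_{x,y}\max_z P_{\rho_k}(x,y,z)$. Then any accumulation point of $\{(x^k,y^k)\}$ is an optimal solution of the bilevel problem $$\min_{x,y}\ f(x,y)\quad\text{s.t.}\quad y\in\operatorname{argmin}_z \tilde f(x,z).$$
   Context: Setting. $f(x,y)=f_1(x,y)+f_2(x)$ and $\tilde f(x,y)=\tilde f_1(x,y)+\tilde f_2(y)$ for $x\in\mathbb R^n$, $y\in\mathbb R^m$, where $f_2:\mathbb R^n\to\mathbb R\cup\{\infty\}$ and $\tilde f_2:\mathbb R^m\to\mathbb R\cup\{\infty\}$ are proper closed convex functions. Put $\mathcal X=\operatorname{dom} f_2$ and $\mathcal Y=\operatorname{dom}\tilde f_2$. It is assumed that: (i) $f$ and $\tilde f$ are continuous on $\mathcal X\times\mathcal Y$; $\tilde f_1(x,\cdot)$ is convex for every $x\in\mathcal X$; $f_1$ and $\tilde f_1$ are respectively $L_{\nabla f_1}$-smooth and $L_{\nabla\tilde f_1}$-smooth on $\mathcal X\times\mathcal Y$ (i.e. their gradients are Lipschitz continuous there with these constants); (ii) the proximal operators of $f_2$ and $\tilde f_2$ can be exactly evaluated; (iii) $\mathcal X$ and $\mathcal Y$ are compact. The bilevel problem in the claim is assumed to have at least one optimal solution. For $\rho>0$, $P_\rho(x,y,z)=f(x,y)+\rho(\tilde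 f(x,y)-\tilde f(x,z))$. Minimization over $(x,y)$ is effectively over $\mathcal X\times\mathcal Y$ and optimization over $z$ is effectively over $\mathcal Y$. For a minimax problem $\Psi^*=\min_u\max_v\Psi(u,v)$ with $\Psi^*$ finite, a point $(u_\epsilon,v_\epsilon)$ is an $\epsilon$-optimal solution if $\max_v\Psi(u_\epsilon,v)-\Psi(u_\epsilon,v_\epsilon)\le\epsilon$ and $\Psi(u_\epsilon,v_\epsilon)-\Psi^*\le\epsilon$. This is applied with $u=(x,y)$ and $v=z$. *)

(* Defs.v *)
From HB Require Import structures.
From mathcomp Require Import all_boot all_order all_algebra.
From mathcomp Require Import all_classical all_reals all_analysis.

Set Implicit Arguments.
Unset Strict Implicit.
Unset Printing Implicit Defensive.

Import Order.TTheory GRing.Theory Num.Theory.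
Import numFieldNormedType.Exports.

Local Open Scope classical_set_scope.
Local Open Scope ring_scope.

Section ExtendedRealFunctions.
Context {R : realType}.

Definition argmin {T : Type} (h : T -> \bar R) : set T :=
  [set x | forall u, (h x <= h u)%E].

Definition dom {T : Type} (h : T -> \bar R) : set T :=
  [set x | (h x < +oo)%E].

Definition proper {T : Type} (h : T -> \bar R) : Prop :=
  (forall x, (-oo < h x)%E) /\ dom h !=set0.

Definition epigraph {T : Type} (h : T -> \bar R) : set (T * R^o) :=
  [set p | (h p.1 <= (p.2 : R)%:E)%E].

Definition proper_closed_convex {n : nat} (h : 'rV[R]_n -> \bar R) : Prop :=
  [/\ proper h, closed (epigraph h) &
      convex_set (epigraph h : set (convex_lmodType ('rV[R]_n * R^o)%type))].

End ExtendedRealFunctions.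

Section Smoothness.
Context {R : realType}.

(* The library norm on row vectors is the sup norm. *)
Definition enorm {n : nat} (v : 'rV[R]_n) : R :=
  Num.sqrt (\sum_(i < n) v 0 i ^+ 2).

Definition edist {n m : nat} (p q : 'rV[R]_n * 'rV[R]_m) : R :=
  enorm (row_mx (p.1 - q.1) (p.2 - q.2)).

Definition gradient {n m : nat} (h : 'rV[R]_n * 'rV[R]_m -> R^o)
    (p : 'rV[R]_n * 'rV[R]_m) : 'rV[R]_(n + m) :=
  row_mx (\row_(i < n) 'D_(delta_mx 0 i, 0) h p)
         (\row_(j < m) 'D_(0, delta_mx 0 j) h p).

Definition smooth_on {n m : nat} (L : R) (A : set ('rV[R]_n * 'rV[R]_m))
    (h : 'rV[R]_n * 'rV[R]_m -> R^o) : Prop :=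
  (forall p, A p -> differentiable h p) /\
  (forall p q, A p -> A q ->
     enorm (gradient h p - gradient h q) <= L * edist p q).

(* Exact evaluability of prox_h, modelled as a function returning its value. *)
Definition is_prox {n : nat} (h : 'rV[R]_n -> \bar R)
    (prox : 'rV[R]_n -> 'rV[R]_n) : Prop :=
  forall x, argmin (fun u => ((enorm (u - x) ^+ 2 / 2)%:E + h u)%E)
            = [set prox x].

End Smoothness.

Section Problems.
Context {R : realType}.

Definition upper_obj {n m : nat} (f1 : 'rV[R]_n * 'rV[R]_m -> R)
    (f2 : 'rV[R]_n -> \bar R) (p : 'rV[R]_n * 'rV[R]_m) : \bar R :=
  ((f1 p)%:E + f2 p.1)%E.

Definition lower_obj {n m : nat} (g1 : 'rV[R]_n * 'rV[R]_m -> R)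
    (g2 : 'rV[R]_m -> \bar R) (p : 'rV[R]_n * 'rV[R]_m) : \bar R :=
  ((g1 p)%:E + g2 p.2)%E.

Definition bilevel_feasible {T1 T2 : Type} (g : T1 * T2 -> \bar R) :
    set (T1 * T2) :=
  [set p | argmin (fun z => g (p.1, z)) p.2].

Definition bilevel_optimal {T1 T2 : Type} (f g : T1 * T2 -> \bar R)
    (p : T1 * T2) : Prop :=
  bilevel_feasible g p /\
  (forall q, bilevel_feasible g q -> (f p <= f q)%E).

(* To be used only where [f] and [g] are finite: elsewhere the value is
   governed by the library convention +oo - +oo = -oo. *)
Definition penalty {T1 T2 : Type} (f g : T1 * T2 -> \bar R) (rho : R)
    (p : T1 * T2) (z : T2) : \bar R :=
  (f p + rho%:E * (g p - g (p.1, z)))%E.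

(* Maxima and minima over u, v are read as suprema and infima in \bar R. *)
Definition max_value {U V : Type} (B : set V) (Psi : U -> V -> \bar R)
    (u : U) : \bar R :=
  ereal_sup [set Psi u v | v in B].

Definition minimax_value {U V : Type} (A : set U) (B : set V)
    (Psi : U -> V -> \bar R) : \bar R :=
  ereal_inf [set max_value B Psi u | u in A].

Definition eps_optimal {U V : Type} (A : set U) (B : set V)
    (Psi : U -> V -> \bar R) (eps : R) (u : U) (v : V) : Prop :=
  [/\ minimax_value A B Psi \is a fin_num, A u, B v,
      (max_value B Psi u - Psi u v <= eps%:E)%E &
      (Psi u v - minimax_value A B Psi <= eps%:E)%E].

End Problems.

(* Main.v *)
Require Import Defs.
From HB Require Import structures.
From mathcomp Require Import all_boot all_order all_algebra.
From mathcomp Require Import all_classical all_reals all_analysis.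
From mathcomp Require Import ring lra.

Set Implicit Arguments.
Unset Strict Implicit.
Unset Printing Implicit Defensive.

Import Order.TTheory GRing.Theory Num.Theory.
Import numFieldNormedType.Exports.

Local Open Scope classical_set_scope.
Local Open Scope ring_scope.

(** Write [A = X * Y], let [u_k] be the given points and let [q] in [A] be
    feasible for the bilevel problem. Since [q] minimizes [g (q.1, _)], the
    penalty term at [q] is nonpositive for every [z], so the minimax value is at
    most [f q] whatever [rho_k] is. Near-optimality of [u_k] then gives, for all
    [w] in [Y],
      [f u_k + rho_k * (g u_k - g (u_k.1, w)) <= f q + 2 * eps_k]
    ([eps_optimal_penalty_le]). Two choices of [w] give the two halves of
    optimality at an accumulation point [p].

    With [w = u_k.2] the penalty cancels and [f u_k <= f q + 2 * eps_k], so
    [f p <= f q] by continuity. With [w] fixed, [f] being bounded below on the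
    compact set [A], the gap [g u_k - g (u_k.1, w)] is at most a bounded quantity
    divided by [rho_k], so [g p <= g (p.1, w)]: [p] is feasible. Both passages to
    the limit are instances of [cluster_le].

    The second bound needs one feasible [q] with [f q] finite, and
    [exists_feasible] provides it. Points outside [A] have an infinite upper or
    lower value, so they compete in neither minimization. *)

(** * Limits along cluster points *)

Lemma cluster_frequently (T : topologicalType) (u : nat -> T) (p : T)
    (P : set T) (Q : set nat) :
  cluster (u @ \oo) p -> nbhs p P -> (\forall k \near \oo, Q k) ->
  exists2 k, P (u k) & Q k.
Proof.
move=> up pP oQ.
have [_ [[k Qk <-] Pk]] : (u @` Q) `&` P !=set0.
  by apply: up => //; apply: filterS oQ => k Qk; exists k.
by exists k.
Qed.

(** Stated with [within A] because the objectives are continuous only relative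
    to their domain. *)
Lemma cluster_le (R : realType) (T : topologicalType) (A : set T) (h : T -> R)
    (u : nat -> T) (c : nat -> R) (l : R) (p : T) :
  (forall k, A (u k)) -> cluster (u @ \oo) p ->
  h @ within A (nbhs p) --> h p -> c @ \oo --> l ->
  (forall k, h (u k) <= c k) -> h p <= l.
Proof.
move=> Au up hp cl huc; apply/ler_addgt0Pr => e e0.
have e20 : 0 < e / 2 by rewrite divr_gt0.
have hpe : \forall q \near within A (nbhs p), h p - e / 2 < h q.
  by apply: (cvgr_gt (h p) hp); rewrite ltrBlDr ltrDl.
have cle : \forall k \near \oo, c k < l + e / 2.
  by apply: (cvgr_lt l cl); rewrite ltrDl.
have [k hk ck] := cluster_frequently up hpe cle.
have := hk (Au k); have := huc k; move: ck; lra.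
Qed.

Lemma cluster_mem (T : topologicalType) (A : set T) (u : nat -> T) (p : T) :
  closed A -> (forall k, A (u k)) -> cluster (u @ \oo) p -> A p.
Proof.
move=> clA Au up; apply: clA => B pB.
have [k Bk _] := cluster_frequently up pB filterT.
by exists (u k).
Qed.

Lemma within_continuous_fine (R : realType) (T : topologicalType) (A : set T)
    (h : T -> \bar R) :
  (forall t, A t -> h t \is a fin_num) -> {within A, continuous h} ->
  {within A, continuous (fine \o h)}.
Proof.
move=> hfin /subspace_continuousP hc; apply/subspace_continuousP => t At.
by apply: fine_cvg; rewrite fineK ?hfin//; exact: hc.
Qed.

Lemma cvg_within_comp (T S U : topologicalType) (A : set T) (B : set S)
    (phi : T -> S) (h : S -> U) (x : T) (y : S) (l : U) :
  phi @ x --> y -> (forall t, A t -> B (phi t)) ->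
  h @ within B (nbhs y) --> l ->
  (fun t => h (phi t)) @ within A (nbhs x) --> l.
Proof.
move=> phiy AB hl V /hl hV.
have hphiV : \forall t \near x, B (phi t) -> V (h (phi t)) := phiy _ hV.
suff : \forall t \near x, A t -> V (h (phi t)) by [].
by apply: filterS hphiV => t + /AB; exact.
Qed.

Lemma within_continuous_slice (T1 T2 S : topologicalType) (X : set T1)
    (Y : set T2) (h : T1 * T2 -> S) (z : T2) :
  {within X `*` Y, continuous h} -> Y z ->
  {within X `*` Y, continuous (fun p => h (p.1, z))}.
Proof.
move=> /subspace_continuousP hc Yz; apply/subspace_continuousP => -[a b] [Xa Yb].
apply: (cvg_within_comp (B := X `*` Y) (phi := fun p => (p.1, z)) (y := (a, z))).
- exact: (cvg_pair (cvg_fst (F := nbhs a) (G := nbhs b)) (cvg_cst z)).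
- by move=> q [].
- by apply: hc; split.
Qed.

(** * The minimax penalty problem *)

(** The two defining inequalities of an [eps]-optimal pair lose [eps] each on
    the way from the minimax value to the inner maximum at [u]. *)
Lemma eps_optimal_le (R : realType) (U V : Type) (A : set U) (B : set V)
    (Psi : U -> V -> \bar R) (eps : R) (u q : U) (v w : V) :
  eps_optimal A B Psi eps u v -> Psi u v \is a fin_num -> A q -> B w ->
  (Psi u w <= max_value B Psi q + (2 * eps)%:E)%E.
Proof.
move=> [valfin Au Bv maxle vle] uvfin Aq Bw.
apply: (@le_trans _ _ (max_value B Psi u)); first by apply: ereal_sup_ubound; exists w.
move: maxle; rewrite leeBlDr// => /le_trans; apply.
move: vle; rewrite leeBlDr// => vle.
apply: (@le_trans _ _ (eps%:E + (eps%:E + minimax_value A B Psi))%E).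
  by rewrite leeD2l.
rewrite addeA -EFinD addeC (_ : eps + eps = 2 * eps); last by ring.
by rewrite leeD2r// ereal_inf_lbound//; exists q.
Qed.

(** At a feasible point the penalty term is nonpositive whatever [z], so the
    inner maximum is bounded by the upper objective, uniformly in [rho]. *)
Lemma max_penalty_feasible (R : realType) (T1 T2 : Type) (Y : set T2)
    (f g : T1 * T2 -> \bar R) (rho : R) (q : T1 * T2) :
  0 < rho -> bilevel_feasible g q -> (max_value Y (penalty f g rho) q <= f q)%E.
Proof.
move=> rho0 feas; apply: ge_ereal_sup => _ [w _ <-].
rewrite /penalty geeDl// mule_ge0_le0//; first by rewrite lee_fin ltW.
by rewrite sube_le0; have := feas w; rewrite /= -surjective_pairing.
Qed.

Lemma penaltyE (R : realType) (T1 T2 : Type) (f g : T1 * T2 -> \bar R)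
    (rho : R) (u : T1 * T2) (w : T2) :
  f u \is a fin_num -> g u \is a fin_num -> g (u.1, w) \is a fin_num ->
  penalty f g rho u w =
    (fine (f u) + rho * (fine (g u) - fine (g (u.1, w))))%:E.
Proof.
by move=> fu gu gw; rewrite /penalty EFinD EFinM EFinB !fineK.
Qed.

(** The quantitative estimate behind the theorem. Taking [w = u.2] cancels the
    penalty term and bounds [f u]; any other [w] bounds [rho] times the lower
    level gap. *)
Lemma eps_optimal_penalty_le (R : realType) (T1 T2 : Type) (X : set T1)
    (Y : set T2) (f g : T1 * T2 -> \bar R) (rho eps : R) (u q : T1 * T2)
    (v w : T2) :
  (forall p, (X `*` Y) p -> f p \is a fin_num) ->
  (forall p, (X `*` Y) p -> g p \is a fin_num) ->
  0 < rho -> eps_optimal (X `*` Y) Y (penalty f g rho) eps u v ->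
  (X `*` Y) q -> bilevel_feasible g q -> Y w ->
  fine (f u) + rho * (fine (g u) - fine (g (u.1, w))) <= fine (f q) + 2 * eps.
Proof.
move=> ffin gfin rho0 opt Aq feas Yw; have [_ Au Yv _ _] := opt.
have slicefin t : Y t -> g (u.1, t) \is a fin_num.
  by move=> Yt; apply: gfin; split=> //; case: Au.
have uvfin : penalty f g rho u v \is a fin_num.
  by rewrite penaltyE ?ffin ?(gfin _ Au) ?slicefin.
have := eps_optimal_le opt uvfin Aq Yw.
rewrite penaltyE ?ffin ?(gfin _ Au) ?slicefin// => /le_trans le_q.
rewrite -lee_fin [leRHS]EFinD (fineK (ffin _ Aq)); apply: le_q.
by rewrite leeD2r// max_penalty_feasible.
Qed.

(** * Accumulation points *)

(** Some feasible point with finite upper value is what makes the estimate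
    above usable; compactness of [Y] provides one over every [a] in [X]. *)
Lemma exists_feasible (R : realType) (T1 T2 : topologicalType) (X : set T1)
    (Y : set T2) (g : T1 * T2 -> \bar R) (a : T1) :
  compact Y -> Y !=set0 -> X a ->
  (forall p, (X `*` Y) p -> g p \is a fin_num) ->
  (forall c z, ~ Y z -> g (c, z) = +oo%E) ->
  {within X `*` Y, continuous g} ->
  exists2 b, Y b & bilevel_feasible g (a, b).
Proof.
move=> cY Y0 Xa gfin goo gc.
have sc : {within Y, continuous (fun b => fine (g (a, b)))}.
  move/(within_continuous_fine gfin)/subspace_continuousP : gc => gc.
  apply/subspace_continuousP => b Yb.
  apply: (cvg_within_comp (B := X `*` Y) (phi := pair a) (h := fine \o g)
            (y := (a, b))).
  - exact: (cvg_pair (cvg_cst a) (@cvg_id _ (nbhs b))).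
  - by move=> c Yc; split.
  - by apply: gc; split.
have [b + bmin] := compact_EVT_min Y0 cY sc; rewrite inE => Yb.
exists b => // z /=; have [Yz|nYz] := pselect (Y z); last first.
  by rewrite (goo _ _ nYz) leey.
rewrite -(fineK (gfin (a, b) _))// -(fineK (gfin (a, z) _))//.
by rewrite lee_fin bmin// inE.
Qed.

(** Finiteness on [X * Y] lets the estimates and their limits be taken in [R];
    the infinite values elsewhere rule out every competitor that those limits
    do not reach. *)
Lemma penalty_cluster_optimal (R : realType) (T1 T2 : topologicalType)
    (X : set T1) (Y : set T2) (f g : T1 * T2 -> \bar R) (rho eps : nat -> R)
    (u : nat -> T1 * T2) (z : nat -> T2) :
  compact X -> compact Y -> closed (X `*` Y) ->
  (forall p, (X `*` Y) p -> f p \is a fin_num) ->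
  (forall p, (X `*` Y) p -> g p \is a fin_num) ->
  (forall c b, ~ X c -> f (c, b) = +oo%E) ->
  (forall c b, ~ Y b -> g (c, b) = +oo%E) ->
  {within X `*` Y, continuous f} -> {within X `*` Y, continuous g} ->
  (forall k, 0 < rho k) -> rho @ \oo --> +oo -> eps @ \oo --> (0 : R) ->
  (forall k, eps_optimal (X `*` Y) Y (penalty f g (rho k)) (eps k) (u k) (z k)) ->
  forall p, cluster (u @ \oo) p -> bilevel_optimal f g p.
Proof.
move=> cX cY clXY ffin gfin foo goo fc gc rho0 rhooo eps0 opt p up.
have Au k : (X `*` Y) (u k) by case: (opt k).
have [Xp Yp] : (X `*` Y) p := cluster_mem clXY Au up.
have Ap : (X `*` Y) p by [].
have fc' := within_continuous_fine ffin fc.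
have gc' := within_continuous_fine gfin gc.
have bound q w k : (X `*` Y) q -> bilevel_feasible g q -> Y w ->
    fine (f (u k)) + rho k * (fine (g (u k)) - fine (g ((u k).1, w)))
    <= fine (f q) + 2 * eps k.
  exact: eps_optimal_penalty_le ffin gfin (rho0 k) (opt k).
have upper_cvg q : fine (f q) + 2 * eps k @[k --> \oo] --> fine (f q).
  rewrite -[X in _ --> X]addr0 -[X in _ + X](mulr0 2).
  by apply: cvgD; [exact: cvg_cst | exact: cvgMr].
split.
- have [b Yb feas] := exists_feasible cY (ex_intro _ _ Yp) Xp gfin goo gc.
  have Ab : (X `*` Y) (p.1, b) by [].
  have [r _ fmin] :=
    compact_EVT_min (ex_intro _ _ Ap) (compact_setX cX cY) fc'.
  move=> w /=; have [Yw|nYw] := pselect (Y w); last first.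
    by rewrite (goo _ _ nYw) leey.
  rewrite (_ : (p.1, p.2) = p); last by case: (p).
  rewrite -(fineK (gfin _ Ap)) -(fineK (gfin (p.1, w) _))// lee_fin -subr_le0.
  (* [r] minimizes [f] on the domain, so [C] does not involve [u]. *)
  pose gap q := fine (g q) - fine (g (q.1, w)).
  pose C k := (fine (f (p.1, b)) + 2 * eps k - fine (f r)) * (rho k)^-1.
  apply: (@cluster_le _ _ (X `*` Y) gap u C 0 p Au up).
  + apply: cvgB; first by move/subspace_continuousP : gc'; exact.
    by move/subspace_continuousP : (within_continuous_slice gc' Yw); exact.
  + rewrite -(mulr0 (fine (f (p.1, b)) - fine (f r))); apply: cvgM.
      by apply: cvgB; [exact: upper_cvg | exact: cvg_cst].
    by apply/gtr0_cvgV0; [exact: nearW | exact: rhooo].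
  + move=> k; rewrite /C ler_pdivlMr// mulrC lerBrDl.
    apply: le_trans (bound _ _ k Ab feas Yw); rewrite lerD2r.
    by apply: fmin; rewrite inE; exact: Au.
- move=> [c d] feas; have [Xc|nXc] := pselect (X c); last first.
    by rewrite (foo _ _ nXc) leey.
  (* Otherwise [d] would minimize [g (c, _)] with value +oo, although
     [g (c, p.2)] is finite. *)
  have Yd : Y d.
    apply: contrapT => nYd; have := feas p.2.
    rewrite /= (goo _ _ nYd) leye_eq => /eqP gcp.
    by have := gfin (c, p.2) (conj Xc Yp); rewrite gcp.
  have Acd : (X `*` Y) (c, d) by [].
  rewrite -(fineK (ffin _ Ap)) -(fineK (ffin _ Acd)) lee_fin.
  apply: (@cluster_le _ _ (X `*` Y) (fine \o f) u _ _ p Au up _ (upper_cvg _)).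
    by move/subspace_continuousP : fc'; exact.
  move=> k; have [_ Yu] := Au k.
  have := bound _ _ k Acd feas Yu.
  by rewrite -surjective_pairing subrr mulr0 addr0.
Qed.

Theorem theorem1 (R : realType) (n m : nat)
  (f1 ft1 : 'rV[R]_n * 'rV[R]_m -> R)
  (f2 : 'rV[R]_n -> \bar R) (ft2 : 'rV[R]_m -> \bar R)
  (Lf1 Lft1 : R)
  (prox_f2 : 'rV[R]_n -> 'rV[R]_n) (prox_ft2 : 'rV[R]_m -> 'rV[R]_m)
  (rho eps : nat -> R)
  (x : nat -> 'rV[R]_n) (y z : nat -> 'rV[R]_m) :
  let f := upper_obj f1 f2 in
  let ft := lower_obj ft1 ft2 in
  let X := dom f2 in
  let Y := dom ft2 in
  proper_closed_convex f2 ->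
  proper_closed_convex ft2 ->
  {within X `*` Y, continuous f} ->
  {within X `*` Y, continuous ft} ->
  (forall a, X a -> convex_function [set: 'rV[R]_m] (fun b => ft1 (a, b))) ->
  smooth_on Lf1 (X `*` Y) f1 ->
  smooth_on Lft1 (X `*` Y) ft1 ->
  is_prox f2 prox_f2 ->
  is_prox ft2 prox_ft2 ->
  compact X ->
  compact Y ->
  (exists p, bilevel_optimal f ft p) ->
  (forall k, 0 < rho k) ->
  (forall k, 0 < eps k) ->
  rho @ \oo --> +oo ->
  eps @ \oo --> (0 : R) ->
  (forall k, eps_optimal (X `*` Y) Y (penalty f ft (rho k)) (eps k)
               (x k, y k) (z k)) ->
  forall p : 'rV[R]_n * 'rV[R]_m,
    cluster ((fun k => (x k, y k)) @ \oo) p ->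
    bilevel_optimal f ft p.
Proof.
move=> f g X Y [[f2ninf _] _ _] [[g2ninf _] _ _] fc gc _ _ _ _ _ cX cY _ rho0 _.
move=> rhooo eps0 opt p up.
have f2fin a : X a -> f2 a \is a fin_num.
  by move=> Xa; rewrite fin_numElt f2ninf.
have g2fin b : Y b -> ft2 b \is a fin_num.
  by move=> Yb; rewrite fin_numElt g2ninf.
have domC (T : Type) (h : T -> \bar R) t : ~ dom h t -> h t = +oo%E.
  by move=> /negP; rewrite -leNgt leye_eq => /eqP.
have clXY : closed (X `*` Y).
  by apply: compact_closed; [exact: norm_hausdorff | exact: compact_setX].
apply: (penalty_cluster_optimal cX cY clXY _ _ _ _ fc gc rho0 rhooo eps0 opt up).
- by move=> [a b] [Xa _]; rewrite /f /upper_obj fin_numD /= f2fin.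
- by move=> [a b] [_ Yb]; rewrite /g /lower_obj fin_numD /= g2fin.
- by move=> a b nXa; rewrite /f /upper_obj /= (domC _ _ _ nXa).
- by move=> a b nYb; rewrite /g /lower_obj /= (domC _ _ _ nYb).
Qed.
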